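(* Let $G$ be a finite non-cyclic nilpotent group. Then the proper enhanced power graph $\mathcal{E}^{**}(G)$ is claw-free if and only if there exist a prime $p$, a non-cyclic finite $p$-group $P$ and a positive integer $n$ such that: (i) $G\cong P\times C_n$ and $\gcd(|P|,n)=1$; (ii) $\mathcal{E}^{**}(P)$ is claw-free.
   Context: For a finite group $G$, the enhanced power graph $\mathcal{E}(G)$ is the graph with vertex set $G$ in which two distinct vertices $u,v$ are adjacent if and only if $\langle u,v\rangle$ is cyclic. A vertex is dominating if it is adjacent to all other vertices. The proper enhanced power graph $\mathcal{E}^{**}(G)$ is the subgraph of $\mathcal{E}(G)$ induced on the non-dominating vertices. A graph is claw-free if it has no induced subgraph isomorphic to $K_{1,3}$. $C_n$ denotes the cyclic group of order $n$. *)

(* Defs.v *)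
From HB Require Import structures.
From mathcomp Require Import all_boot all_algebra all_fingroup all_solvable.

Set Implicit Arguments.
Unset Strict Implicit.
Unset Printing Implicit Defensive.

Import GroupScope.

Record sgraph := SGraph {
  vertex :> finType;
  adj : rel vertex;
  adj_sym : symmetric adj;
  adj_irrefl : irreflexive adj
}.

Definition graph_iso (X Y : sgraph) : Prop :=
  exists2 f : X -> Y,
    bijective f & forall x y : X, adj (f x) (f y) = adj x y.

Section Induced.
Variables (X : sgraph) (S : {set X}).

Definition induced_adj : rel {x : X | x \in S} :=
  fun u v => adj (val u) (val v).

Fact induced_adj_sym : symmetric induced_adj.
Proof. by move=> u v; exact: adj_sym. Qed.

Fact induced_adj_irrefl : irreflexive induced_adj.
Proof. by move=> u; exact: adj_irrefl. Qed.

Definition induced : sgraph := SGraph induced_adj_sym induced_adj_irrefl.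

End Induced.

Section CompleteBipartite.
Variables m n : nat.

Definition biclique_adj : rel ('I_m + 'I_n)%type :=
  fun u v => match u, v with
             | inl _, inr _ | inr _, inl _ => true
             | _, _ => false
             end.

Fact biclique_adj_sym : symmetric biclique_adj.
Proof. by case=> ? [] ?. Qed.

Fact biclique_adj_irrefl : irreflexive biclique_adj.
Proof. by case. Qed.

Definition biclique : sgraph := SGraph biclique_adj_sym biclique_adj_irrefl.

End CompleteBipartite.

Definition claw_free (X : sgraph) : Prop :=
  forall S : {set X}, ~ graph_iso (induced S) (biclique 1 3).

Definition dominating (X : sgraph) (v : X) : bool :=
  [forall u : X, (u != v) ==> adj v u].

Section EnhancedPowerGraph.
Variables (gT : finGroupType) (G : {group gT}).

Definition epg_adj : rel (subg_of G) :=
  fun u v => (u != v) && cyclic <<[set sgval u; sgval v]>>.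

Fact epg_adj_sym : symmetric epg_adj.
Proof. by move=> u v; rewrite /epg_adj eq_sym setUC. Qed.

Fact epg_adj_irrefl : irreflexive epg_adj.
Proof. by move=> u; rewrite /epg_adj eqxx. Qed.

Definition enhanced_power_graph : sgraph := SGraph epg_adj_sym epg_adj_irrefl.

Definition proper_enhanced_power_graph : sgraph :=
  induced [set v : enhanced_power_graph | ~~ dominating v].

End EnhancedPowerGraph.

(* Main.v *)
(** For coprime direct factors A and B, the subgroup generated by ab and a'b' is
    cyclic iff those generated by a, a' and by b, b' are.  Hence a cyclic coprime
    factor can be projected away without destroying claws.  If both factors are
    non-cyclic there is always a claw: pick x, y in A generating a non-cyclic
    subgroup; then x, y, xy are pairwise non-adjacent, yet all are adjacent to
    any element of B, in particular to a non-dominating one.  So in a nilpotent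
    group with a claw-free graph exactly one Sylow subgroup is non-cyclic. *)
Require Import Defs.
From HB Require Import structures.
From mathcomp Require Import all_boot all_algebra all_fingroup all_solvable.

Import GroupScope.

(** An induced claw is the image of an embedding of [biclique 1 3], hence determined by its centre
    and leaves. Irreflexivity lets the condition on leaves include [i = j]. *)
Lemma claw_freeP (X : sgraph) :
  claw_free X <->
  ~ exists (c : X) (x : 'I_3 -> X),
      [/\ injective x, forall i, adj c (x i) & forall i j, ~~ adj (x i) (x j)].
Proof.
split=> [clawF [c [x [x_inj cx xx]]] | noclaw S [f [g fK gK] fE]].
- pose h (v : biclique 1 3) : X := if v is inr i then x i else c.
  have h_adj u v : adj (h u) (h v) = adj u v.
    case: u v => [i|i] [j|j] /=; rewrite ?adj_irrefl ?cx //.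
      by rewrite adj_sym cx.
    by rewrite (negbTE (xx i j)).
  have h_inj : injective h.
    move=> [i|i] [j|j] /= eq_h; first by rewrite !ord1.
    + by have := cx j; rewrite eq_h adj_irrefl.
    + by have := cx i; rewrite -eq_h adj_irrefl.
    + by rewrite (x_inj _ _ eq_h).
  pose S := [set h v | v in [set: biclique 1 3]].
  have hS v : h v \in S by apply: imset_f; rewrite inE.
  pose k v : induced S := exist _ (h v) (hS v).
  have k_inj : injective k by move=> u v [] /h_inj.
  have k_onto (s : induced S) : exists v, k v == s.
    by case/imsetP: (valP s) => v _ sE; exists v; apply/eqP/val_inj.
  (* The isomorphism must go from the induced subgraph to the claw, so [k] is inverted by choosing
     preimages. *)
  pose f s := xchoose (k_onto s).
  have fK : cancel f k by move=> s; apply/eqP/(xchooseP (k_onto s)).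
  apply: (clawF S); exists f; first by exists k => // v; apply/k_inj/fK.
  by move=> s t; rewrite -h_adj -{2}(fK s) -{2}(fK t).
- apply: noclaw; exists (val (g (inl ord0))), (fun i => val (g (inr i))).
  have g_adj u v : adj (val (g u)) (val (g v)) = adj u v.
    by rewrite -{2}(gK u) -{2}(gK v) fE.
  split=> [i j /val_inj/(can_inj gK) [] // | i | i j]; by rewrite g_adj.
Qed.

Definition cyc2 {gT : finGroupType} (x y : gT) := cyclic <<[set x; y]>>.

(* [u] witnesses that the centre [c] is non-dominating; each leaf is
   non-dominating because of the other two, and differs from [c] for the same
   reason. *)
Definition has_claw {gT : finGroupType} (G : {set gT}) :=
  exists (c u : gT) (x : 'I_3 -> gT),
    [/\ c \in G, u \in G & forall i, x i \in G] /\
    [/\ ~~ cyc2 c u, forall i, cyc2 c (x i)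
      & forall i j, i != j -> ~~ cyc2 (x i) (x j)].

Lemma cyc2C {gT : finGroupType} (x y : gT) : cyc2 x y = cyc2 y x.
Proof. by rewrite /cyc2 setUC. Qed.

Lemma cyc2xx {gT : finGroupType} (x : gT) : cyc2 x x.
Proof. by rewrite /cyc2 setUid cycle_cyclic. Qed.

Lemma cyc2x1 {gT : finGroupType} (x : gT) : cyc2 x 1.
Proof.
apply: cyclicS (cycle_cyclic x).
by rewrite gen_subG subUset !sub1set cycle_id group1.
Qed.

Lemma claw_free_properP {gT : finGroupType} (G : {group gT}) :
  claw_free (proper_enhanced_power_graph G) <-> ~ has_claw G.
Proof.
have adjE (u v : enhanced_power_graph G) :
  adj u v = (u != v) && cyc2 (sgval u) (sgval v) by [].
have ndomP (v : enhanced_power_graph G) :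
    reflect (exists2 u, u \in G & ~~ cyc2 (sgval v) u) (~~ dominating v).
  rewrite negb_forall; apply: (iffP existsP) => [[u] | [u Gu vu]].
    rewrite negb_imply adjE eq_sym => /andP[-> /= vu].
    by exists (sgval u) => //; apply: subgP.
  exists (subg G u); rewrite negb_imply adjE subgK // (negbTE vu) andbF andbT.
  by apply: contraNneq vu => <-; rewrite subgK // cyc2xx.
have adjPE (s t : proper_enhanced_power_graph G) :
  adj s t = (val s != val t) && cyc2 (sgval (val s)) (sgval (val t)) by [].
have mem_ndom (v : proper_enhanced_power_graph G) : ~~ dominating (val v).
  by have := valP v; rewrite inE.
have other (i : 'I_3) : exists j, i != j.
  by have [-> | ni0] := eqVneq i ord0; [exists ord_max | exists ord0].
split=> [/claw_freeP noclaw [c [u [x [[Gc Gu Gx] [ncu cx xx]]]]] | noclaw].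
- apply: noclaw.
  have xx1 i : exists2 w, w \in G & ~~ cyc2 (x i) w.
    by have [j ij] := other i; exists (x j) => //; apply: xx.
  (* Vertices are nested subtypes: [mk] packs an element together with the proof that it is
     non-dominating. *)
  have mk y : y \in G -> (exists2 w, w \in G & ~~ cyc2 y w) ->
      {v : proper_enhanced_power_graph G | sgval (val v) = y}.
    move=> Gy nd.
    have Sy : subg G y \in [set v : enhanced_power_graph G | ~~ dominating v].
      by rewrite inE; apply/ndomP; rewrite subgK.
    by exists (exist _ (subg G y) Sy); rewrite /= subgK.
  have [vc vcE] := mk c Gc (ex_intro2 _ _ u Gu ncu).
  pose vx i := sval (mk (x i) (Gx i) (xx1 i)).
  have vxE i : sgval (val (vx i)) = x i by apply: svalP (mk _ _ _).
  exists vc, vx; split=> [i j eq_v | i | i j].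
  + apply: contraTeq (cyc2xx (x i)) => /xx.
    by rewrite -!vxE eq_v.
  + rewrite adjPE vcE vxE cx andbT.
    apply/eqP=> eq_v; have eq_c : c = x i by rewrite -vcE eq_v vxE.
    have [j ij] := other i.
    by have := xx i j ij; rewrite -eq_c cx.
  + rewrite adjPE !vxE; have [-> | ij] := eqVneq i j; first by rewrite eqxx.
    by rewrite (negbTE (xx i j ij)) andbF.
- apply/claw_freeP=> -[c [x [x_inj cx xx]]]; apply: noclaw.
  have [u Gu cu] := ndomP _ (mem_ndom c).
  exists (sgval (val c)), u, (fun i => sgval (val (x i))).
  split; first by split=> // *; apply: subgP.
  split=> // [i | i j ij]; first by case/andP: (cx i).
  by have := xx i j; rewrite adjPE (inj_eq val_inj) (inj_eq x_inj) ij.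
Qed.

(** [cyc2] ignores the ambient group, and the witness [u] persists, so a non-dominating centre stays
    non-dominating in a larger group. *)
Lemma has_clawS {gT : finGroupType} (A B : {set gT}) :
  A \subset B -> has_claw A -> has_claw B.
Proof.
move=> /subsetP sAB [c [u [x [[Ac Au Ax] xP]]]].
by exists c, u, x; split=> //; split=> [||i]; apply: sAB.
Qed.

Lemma isog_has_claw {gT rT : finGroupType} (G : {group gT}) (H : {group rT}) :
  G \isog H -> has_claw G -> has_claw H.
Proof.
case/isogP=> f injf <- [c [u [x [[Gc Gu Gx] [ncu cx xx]]]]].
have fE y z : y \in G -> z \in G -> cyc2 (f y) (f z) = cyc2 y z.
  move=> Gy Gz; have sG : [set y; z] \subset G by rewrite subUset !sub1set Gy.
  have sKG : <<[set y; z]>> \subset G by rewrite gen_subG.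
  by rewrite /cyc2 -(injm_cyclic injf sKG) morphim_gen // morphimU !morphim_set1.
exists (f c), (f u), (fun i => f (x i)); split.
  by split=> [||i]; rewrite mem_morphim.
by split=> [|i|i j ij]; rewrite fE ?xx.
Qed.

(** By coprimality [<[x * y]>] is the product of [<[x]>] and [<[y]>], so a subgroup containing
    [x * y] contains both components. Conversely, a direct product of cyclic groups of coprime
    orders is cyclic. *)
Lemma cyc2_dprod {gT : finGroupType} (A B G : {group gT}) (a a' b b' : gT) :
    A \x B = G -> coprime #|A| #|B| ->
    a \in A -> a' \in A -> b \in B -> b' \in B ->
  cyc2 (a * b) (a' * b') = cyc2 a a' && cyc2 b b'.
Proof.
move=> defG coAB Aa Aa' Bb Bb'; have [_ _ cAB _] := dprodP defG.
have mulE x y : x \in A -> y \in B -> <[x]> * <[y]> = <[x * y]>.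
  move=> Ax By; rewrite cycleM //; first by apply/commute_sym/(centsP cAB).
  exact: coprime_dvdl (order_dvdG Ax) (coprime_dvdr (order_dvdG By) coAB).
have genS (S : {set gT}) x y : x \in A -> y \in B -> x * y \in S ->
    (x \in <<S>>) && (y \in <<S>>).
  move=> Ax By /mem_gen; rewrite -cycle_subG -mulE // -!cycle_subG => sub.
  by rewrite !(subset_trans _ sub) ?mulG_subl ?mulG_subr.
apply/idP/andP=> [cyc | [cycA cycB]].
- have /andP[g1 g2] := genS [set a * b; a' * b'] a b Aa Bb (set21 _ _).
  have /andP[g3 g4] := genS [set a * b; a' * b'] a' b' Aa' Bb' (set22 _ _).
  by split; apply: cyclicS cyc; rewrite gen_subG subUset !sub1set ?g1 ?g2 ?g3.
- have sA : <<[set a; a']>> \subset A by rewrite gen_subG subUset !sub1set Aa.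
  have sB : <<[set b; b']>> \subset B by rewrite gen_subG subUset !sub1set Bb.
  have co : coprime #|<<[set a; a']>>| #|<<[set b; b']>>|.
    exact: coprimeSg sA (coprimegS sB coAB).
  have cents : <<[set b; b']>> \subset 'C(<<[set a; a']>>).
    exact: subset_trans sB (subset_trans cAB (centS sA)).
  have defK := dprodEY cents (coprime_TIg co).
  have cycK : cyclic (<<[set a; a']>> <*> <<[set b; b']>>).
    by rewrite (cyclic_dprod defK).
  apply: cyclicS cycK; rewrite gen_subG subUset !sub1set -(dprodW defK).
  by rewrite !mem_mulg // mem_gen ?set21 ?set22.
Qed.

Lemma has_claw_dprodl {gT : finGroupType} (A B G : {group gT}) :
    A \x B = G -> coprime #|A| #|B| -> cyclic B ->
  has_claw G -> has_claw A.
Proof.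
move=> defG coAB cycB [c [u [x [[Gc Gu Gx] [ncu cx xx]]]]].
have splitG g : g \in G -> {a | a \in A & exists2 b, b \in B & g = a * b}.
  (* A boolean existential yields the component in [A] as data, which is needed to define the leaves
     [ax] as a function. *)
  move=> Gg; have /existsP/sigW[a /andP[Aa Bg]] :
      [exists a, (a \in A) && (a^-1 * g \in B)].
    have [a [b [Aa Bb -> _]]] := mem_dprod defG Gg.
    by apply/existsP; exists a; rewrite Aa mulKg.
  by exists a => //; exists (a^-1 * g); rewrite ?mulKVg.
have cyc2E a b a' b' : a \in A -> b \in B -> a' \in A -> b' \in B ->
    cyc2 (a * b) (a' * b') = cyc2 a a'.
  move=> Aa Bb Aa' Bb'; rewrite (cyc2_dprod A B G) //.
  by rewrite [cyc2 b b'](cyclicS _ cycB) ?andbT // gen_subG subUset !sub1set Bb.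
have [ac Aac [bc Bbc cE]] := splitG c Gc.
have [au Aau [bu Bbu uE]] := splitG u Gu.
pose ax i := s2val (splitG _ (Gx i)).
have Aax i : ax i \in A by apply: s2valP (splitG _ _).
have xE i : exists2 b, b \in B & x i = ax i * b by apply: s2valP' (splitG _ _).
exists ac, au, ax; do !split=> //.
- by rewrite -(cyc2E ac bc au bu) // -cE -uE.
- by move=> i; have [b Bb bE] := xE i; rewrite -(cyc2E ac bc _ b) // -cE -bE.
move=> i j ij; have [b Bb bE] := xE i; have [b' Bb' bE'] := xE j.
by rewrite -(cyc2E _ b _ b') // -bE -bE' xx.
Qed.

(** Take [m] of maximal order and [y] outside [<[m]>]. If both lay in a cyclic [<[z]>] with [z] in
    [G], maximality would force [<[m]> = <[z]>], which contains [y]. *)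
Lemma noncyclic_cyc2 {gT : finGroupType} (G : {group gT}) :
  ~~ cyclic G -> exists x y, [/\ x \in G, y \in G & ~~ cyc2 x y].
Proof.
move=> ncG; pose m := [arg max_(x > 1 in G) #[x]].
have [Gm max_m] : m \in G /\ {in G, forall y, #[y] <= #[m]}.
  by rewrite /m; case: arg_maxnP => // x Gx max_x; split.
have [/subsetP sGm | /subsetPn[y Gy my]] := boolP (G \subset <[m]>).
  by case/negP: ncG; apply: cyclicS (cycle_cyclic m); apply/subsetP.
exists m, y; split=> //; apply: contra my => /cyclicP[z zE].
have /andP[mz yz] : (m \in <[z]>) && (y \in <[z]>).
  by rewrite -zE !mem_gen ?set21 ?set22.
have Gz : z \in G.
  by rewrite -cycle_subG -zE gen_subG subUset !sub1set Gm.
have /eqP-> // : <[m]> == <[z]>.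
by rewrite eqEcard cycle_subG mz max_m.
Qed.

Lemma has_claw_dprod {gT : finGroupType} (A B G : {group gT}) :
    A \x B = G -> coprime #|A| #|B| -> ~~ cyclic A -> ~~ cyclic B ->
  has_claw G.
Proof.
move=> defG coAB /noncyclic_cyc2[x [y [Ax Ay nxy]]].
case/noncyclic_cyc2=> [c [u [Bc Bu ncu]]].
have [_ defAB _ _] := dprodP defG.
have [/subsetP sAG /subsetP sBG] : A \subset G /\ B \subset G.
  by rewrite -defAB mulG_subl mulG_subr.
(* Together with [x * y], either of [x] and [y] generates the other, and subgroups of cyclic groups
   are cyclic. *)
have nx_xy : ~~ cyc2 x (x * y).
  apply: contra nxy => /cyclicS; apply.
  rewrite gen_subG subUset !sub1set mem_gen ?set21 //=.
  by rewrite -(groupMl (x := x)) mem_gen ?set21 ?set22.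
have ny_xy : ~~ cyc2 y (x * y).
  apply: contra nxy => /cyclicS; apply.
  rewrite gen_subG subUset !sub1set andbC mem_gen ?set21 //=.
  by rewrite -(groupMr (x := y)) mem_gen ?set21 ?set22.
pose f (i : 'I_3) := nth 1 [:: x; y; x * y] i.
have Af i : f i \in A by case: i => [[|[|[|]]]] //= *; rewrite /f /= ?groupM.
exists c, u, f; do !split=> //; try by auto.
(* With [c = 1 * c] and [f i = f i * 1], each factor sees a pair containing 1. *)
- move=> i; rewrite -[c]mul1g -[f i]mulg1 (cyc2_dprod A B G) //.
  by rewrite [cyc2 1 _]cyc2C !cyc2x1.
by case=> [[|[|[|]]]] // ? [[|[|[|]]]] //= ? _; rewrite /f //= cyc2C.
Qed.

Theorem corollary2p3 (gT : finGroupType) (G : {group gT})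
    (nilG : nilpotent G) (ncycG : ~~ cyclic G) :
  claw_free (proper_enhanced_power_graph G) <->
  exists (p : nat) (rT : finGroupType) (P : {group rT}) (n : nat),
    [/\ prime p, p.-group P, ~~ cyclic P & (0 < n)%N] /\
    [/\ G \isog setX P (Zp n), coprime #|P| n
      & claw_free (proper_enhanced_power_graph P)].
Proof.
(* For [n <= 1] the type ['Z_n] still has two elements, but [Zp n] is defined to be trivial. *)
have cycZp n : cyclic (Zp n).
  by rewrite /Zp; case: ifP => _; rewrite ?cyclic1 // Zp_cycle cycle_cyclic.
have decP (rT : finGroupType) (P : {group rT}) n :
    setX P [1 'Z_n] \x setX [1 rT] (Zp n) = setX P (Zp n) by apply: setX_dprod.
split=> [/claw_free_properP noclaw | [p [rT [P [n [[_ _ _ n_gt0]]]]]]].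
- have [p pr_p ncP] : exists2 p, prime p & ~~ cyclic 'O_p(G).
    (* A nilpotent group whose Sylow subgroups are all cyclic is cyclic. By nilpotency, the
       non-cyclic Sylow subgroup found is the [p]-core. *)
    have : ~~ Zgroup G by apply: contra ncycG => /nil_Zgroup_cyclic->.
    case/forall_inPn=> S /SylowP[p pr_p sylS] ncS.
    by exists p; rewrite // -(nilpotent_Hall_pcore nilG sylS).
  have defG := nilpotent_pcoreC p nilG.
  have co : coprime #|'O_p(G)| #|'O_p^'(G)|.
    by apply: (@pnat_coprime p); apply: pcore_pgroup.
  have cycC : cyclic 'O_p^'(G).
    by apply: contraT => ncC; case: noclaw; apply: has_claw_dprod defG co ncP ncC.
  exists p, gT, 'O_p(G)%G, #|'O_p^'(G)|; do !split=> //; first exact: pcore_pgroup.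
    apply: isog_dprod defG (decP _ _ _) _ _; first exact: isog_setX1.
    apply: isog_trans (isog_set1X _ _).
    by rewrite isog_cyclic_card // cycZp card_Zp ?eqxx ?cardG_gt0.
  by apply/claw_free_properP => clawP; apply/noclaw/(has_clawS _ _ _ clawP)/pcore_sub.
- case=> isoG co /claw_free_properP noclaw; apply/claw_free_properP => clawG.
  (* A claw of [G] is carried to [setX P (Zp n)], projected to the copy of [P] there, then moved to
     [P]. Positivity of [n] gives [Zp n] order [n], hence coprimality. *)
  apply: noclaw; apply: isog_has_claw (isog_symr (isog_setX1 _ P)) _.
  apply: has_claw_dprodl (decP _ P n) _ _ (isog_has_claw _ _ isoG clawG).
    by rewrite !cardsX !cards1 mul1n muln1 card_Zp.
  by rewrite -(isog_cyclic (isog_set1X _ _)) cycZp.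
Qed.
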